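(* Let $D$ be a signed digraph on $[n]$ with minimum in-degree $\delta\ge\frac{\ln(4n)}{2}$. Then \[ g(D,2)\ge\frac{\delta}{2}-\sqrt{\frac{\ln(4n)\,\delta}{2}}-\log_2 n-1. \]
   Context: A signed digraph on $[n]=\{0,\dots,n-1\}$ is $D=([n],E,\lambda)$ with $E\subseteq[n]\times[n]$ (loops allowed) and $\lambda:E\to\{-1,0,1\}$. For $i\in[n]$, $N^\alpha(i)=\{j:(j,i)\in E,\lambda(j,i)=\alpha\}$ and $N(i)$ is their union; the in-degree of $i$ is $|N(i)|$ and $\delta=\min_i|N(i)|$. $F(D,2)$ is the set of maps $f:\{0,1\}^n\to\{0,1\}^n$ such that each $f_i$ depends only on $x_{N(i)}$, is non-decreasing in $x_j$ when $\lambda(j,i)=1$ and non-increasing in $x_j$ when $\lambda(j,i)=-1$; $g(D,2)=\max_{f\in F(D,2)}\log_2|\mathrm{Fix}(f)|$, where $\mathrm{Fix}(f)$ is the set of fixed points of $f$. *)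

(* Defs.v *)
From mathcomp Require Export all_boot all_order all_algebra.
From mathcomp Require Export all_classical all_reals all_analysis.
Set Implicit Arguments.
Unset Strict Implicit.
Unset Printing Implicit Defensive.
Import Order.TTheory GRing.Theory Num.Theory.
Local Open Scope ring_scope.

(* [lab j i] is the label of the arc from [j] to [i]; only its values on arcs
   are constrained, and only those are used below. *)
Record sdigraph (n : nat) := SDigraph {
  arc : rel 'I_n;
  lab : 'I_n -> 'I_n -> int;
  lab_sign : forall j i, arc j i -> lab j i \in [:: -1; 0; 1]
}.

Definition signed_nbr n (D : sdigraph n) (alpha : int) (i : 'I_n) : {set 'I_n} :=
  [set j | arc D j i && (lab D j i == alpha)].

Definition in_nbr n (D : sdigraph n) (i : 'I_n) : {set 'I_n} :=
  (signed_nbr D (-1) i :|: signed_nbr D 0 i :|: signed_nbr D 1 i)%SET.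

(* Since [#|in_nbr D i| <= n], the neutral element [n] only matters for n = 0. *)
Definition min_indegree n (D : sdigraph n) : nat :=
  \big[minn/n]_(i < n) #|in_nbr D i|.

Definition config (n : nat) := {ffun 'I_n -> bool}.

Section Functions.
Variable n : nat.
Implicit Types (f : {ffun config n -> config n}) (i j : 'I_n) (A : {set 'I_n}).

Definition depends_only_on f i A : bool :=
  [forall x : config n, forall y : config n,
    [forall j in A, x j == y j] ==> (f x i == f y i)].

(* [x] and [y] agree outside [j], and [x j <= y j]. *)
Definition le_at j (x y : config n) : bool :=
  [forall k, (k != j) ==> (x k == y k)] && (x j <= y j)%O.

Definition nondecreasing_in f i j : bool :=
  [forall x : config n, forall y : config n,
    le_at j x y ==> (f x i <= f y i)%O].

Definition nonincreasing_in f i j : bool :=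
  [forall x : config n, forall y : config n,
    le_at j x y ==> (f y i <= f x i)%O].

End Functions.

Definition FD n (D : sdigraph n) : {set {ffun config n -> config n}} :=
  [set f | [forall i,
    [&& depends_only_on f i (in_nbr D i),
        [forall j in signed_nbr D 1 i, nondecreasing_in f i j]
      & [forall j in signed_nbr D (-1) i, nonincreasing_in f i j]]]].

Definition Fix n (f : {ffun config n -> config n}) : {set config n} :=
  [set x | f x == x].

Definition log2 (R : realType) (x : R) : R := ln x / ln 2.

(* The constant maps lie in [FD D] and have exactly one fixed point, so the
   maximum is nonnegative and attained at a map with a fixed point; hence neither
   the neutral element 0 nor the library's value [ln 0 = 0] affects it. *)
Definition guessing_number (R : realType) n (D : sdigraph n) : R :=
  \big[Num.max/0]_(f in FD D) log2 (#|Fix f|%:R : R).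

Lemma log2_nat_ge0 (R : realType) (m : nat) : 0 <= log2 (m%:R : R).
Proof.
rewrite /log2; apply: divr_ge0; last by rewrite ln_ge0 ?ler1n.
by case: m => [|m]; [rewrite ln0 | rewrite ln_ge0 ?ler1n].
Qed.

Lemma guessing_number_ge (R : realType) n (D : sdigraph n) f :
  f \in FD D -> log2 (#|Fix f|%:R : R) <= guessing_number R D.
Proof. by move=> fD; rewrite /guessing_number (bigD1 f) //= le_max lexx. Qed.

Lemma guessing_number_attained (R : realType) n (D : sdigraph n) :
  exists f, [/\ f \in FD D, (0 < #|Fix f|)%N
    & guessing_number R D = log2 (#|Fix f|%:R : R)].
Proof.
pose c : {ffun config n -> config n} := [ffun=> [ffun=> false]].
have cD : c \in FD D.
  rewrite inE; apply/forallP => i; apply/and3P; split.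
  - by apply/forallP => x; apply/forallP => y; rewrite !ffunE eqxx implybT.
  - apply/forall_inP => j _; apply/forallP => x; apply/forallP => y.
    by rewrite !ffunE lexx implybT.
  - apply/forall_inP => j _; apply/forallP => x; apply/forallP => y.
    by rewrite !ffunE lexx implybT.
have cF : #|Fix c| = 1%N.
  rewrite -(cards1 ([ffun=> false] : config n)); apply: eq_card => x.
  by rewrite !inE ffunE eq_sym.
pose P (v : R) := exists f, [/\ f \in FD D, (0 < #|Fix f|)%N
  & v = log2 (#|Fix f|%:R : R)].
have P0 : P 0 by exists c; split; rewrite // cF // /log2 ln1 mul0r.
rewrite -/(P (guessing_number R D)) /guessing_number.
apply: (big_ind P) => // [x y Px Py|f fD]; first by case: leP.
have [F0|F0] := posnP #|Fix f|; last by exists f.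
by rewrite F0 /log2 ln0 // mul0r.
Qed.

(* Main.v *)
(** Fix signs for the arcs (label 0 is read as positive) and keep just [delta]
    in-neighbours [N_i] of every vertex. A set [S] of configurations is fixed by
    a map of [F(D,2)] as soon as, for all [x, y] in [S] and [i] with
    [x_i = 1], [y_i = 0], the signed restriction of [x] to [N_i] is not below
    that of [y]: take for [f_i] the up-closure of [{x in S | x_i = 1}].
    By Hoeffding's inequality and a union bound over the vertices and both signs,
    at least half of all configurations have, on every [N_i], at least
    [a = delta/2 - sqrt(ln(4n) delta/2)] signed zeros and as many signed ones.
    Such a configuration is in conflict with at most [n 2^(n-a)] others, so a
    maximal conflict-free set has at least [2^(n-1) / (n 2^(n-a))] elements. *)
Require Import Defs.
From mathcomp Require Import all_boot all_order all_algebra.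
From mathcomp Require Import all_classical all_reals all_analysis.
From mathcomp Require Import ring lra.
Import Order.TTheory GRing.Theory Num.Theory.
Import numFieldNormedType.Exports.
Local Open Scope ring_scope.

(** * The Gaussian bound on the hyperbolic cosine *)

(** Right side minus left side vanishes at 0 and has derivative [x * (expR x - expR (- x))], which
    is nonnegative for [0 <= x]. *)
Lemma sinh_le_mul_cosh (R : realType) (x : R) : 0 <= x ->
  expR x - expR (- x) <= x * (expR x + expR (- x)).
Proof.
move=> x0; rewrite -subr_ge0.
pose k (y : R) := y * (expR y + expR (- y)) - (expR y - expR (- y)).
have dk (y : R) : is_derive y 1 k (y * (expR y - expR (- y))).
  rewrite /k; apply: is_derive_eq.
  by rewrite /GRing.scale/=; ring.
have <- : k 0 = 0 by rewrite /k oppr0 mul0r !subrr.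
apply: (@ger0_derive1_ndecry _ k 0) => //.
- move=> y /=; rewrite in_itv/= andbT => y0.
  rewrite derive1E derive_val mulr_ge0 ?ltW// subr_gt0 ltr_expR; lra.
- apply: derivable_within_continuous => y _; exact: ex_derive.
Qed.

(** By evenness take [0 <= x]. The quotient of the left side by [expR (x ^+ 2 / 2)] equals 2 at 0,
    and [sinh_le_mul_cosh] makes its derivative nonpositive; [h] is its negative. *)
Lemma cosh_le_expR_sqr (R : realType) (x : R) :
  expR x + expR (- x) <= 2 * expR (x ^+ 2 / 2).
Proof.
wlog x0 : x / 0 <= x.
  move=> H; have [|/ltW xN] := leP 0 x; first exact: H.
  by rewrite addrC -{2}(opprK x) -(sqrrN x); apply: H; rewrite oppr_ge0.
pose h (y : R) := - ((expR y + expR (- y)) * expR (- (y ^+ 2 / 2))).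
have dh (y : R) : is_derive y 1 h
    ((y * (expR y + expR (- y)) - (expR y - expR (- y)))
       * expR (- (y ^+ 2 / 2))).
  rewrite /h; apply: is_derive_eq.
  by rewrite /GRing.scale/=; field.
have : h 0 <= h x.
  apply: (@ger0_derive1_ndecry _ h 0) => //.
  - move=> z /=; rewrite in_itv/= andbT => y0.
    rewrite derive1E derive_val mulr_ge0 ?expR_ge0// subr_ge0.
    exact/sinh_le_mul_cosh/ltW.
  - apply: derivable_within_continuous => y _; exact: ex_derive.
rewrite /h expr0n/= mul0r oppr0 expR0 lerN2 mulr1.
by rewrite [expR (- (_ / _))]expRN ler_pdivrMr ?expR_gt0.
Qed.

(** * Counting and independent sets *)

Lemma card_agree (T : finType) (A : {set T}) (x : {ffun T -> bool}) :
  #|[set y : {ffun T -> bool} | [forall j in A, y j == x j]]|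
    = (2 ^ (#|T| - #|A|))%N.
Proof.
pose F (j : T) : pred bool := [pred b | (j \in A) ==> (b == x j)].
have -> : #|[set y : {ffun T -> bool} | [forall j in A, y j == x j]]|
    = #|(family F : simpl_pred {ffun T -> bool})|.
  by apply: eq_card => y; rewrite inE; apply/forallP/familyP.
rewrite card_family foldrE big_image (bigID [in A])/= big1; last first.
  move=> j jA.
  by rewrite -(card1 (x j)); apply: eq_card => b; rewrite !inE jA.
rewrite mul1n (eq_bigr (fun=> 2%N)) => [|j /negbTE jA]; last first.
  by rewrite -card_bool; apply: eq_card => b; rewrite !inE jA.
by rewrite prod_nat_const -(cardC [in A]) addKn.
Qed.

Lemma card_bigcup_le {I T : finType} (P : pred I) (F : I -> {set T}) :
  (#|\bigcup_(i | P i) F i| <= \sum_(i | P i) #|F i|)%N.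
Proof.
elim/big_rec2: _ => [|i m A _ Am]; first by rewrite cards0.
by rewrite (leq_trans (leq_card_setU _ _))// leq_add2l.
Qed.

(** Take a maximal independent [S] inside [X]: a point of [X] outside every [C x] could be added to
    [S], so these sets cover [X]. *)
Lemma exists_independent_cover {T : finType} (r : rel T) (X : {set T})
    (C : T -> {set T}) :
  symmetric r -> irreflexive r -> (forall x, x \in C x) ->
  (forall x y, r x y -> y \in C x) ->
  exists S : {set T}, [/\ S \subset X, {in S &, forall x y, ~~ r x y}
    & (#|X| <= \sum_(x in S) #|C x|)%N].
Proof.
move=> rs ri xC rC.
pose P (S : {set T}) :=
  (S \subset X) && [forall x in S, forall y in S, ~~ r x y].
have P0 : P finset.set0.
  by rewrite /P finset.sub0set; apply/forall_inP => x; rewrite inE.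
have [S /maxsetP[/andP[SX /forall_inP iS] maxS] _] := maxset_exists P0.
have {}iS : {in S &, forall x y, ~~ r x y}.
  by move=> x y /iS/forall_inP; exact.
exists S; split => //.
have sub : X \subset \bigcup_(x in S) C x.
  apply/fintype.subsetP => y yX; apply: contraT => yNC.
  have yNr x : x \in S -> ~~ r x y.
    by move=> xS; apply: contra yNC => /rC yC; apply/bigcupP; exists x.
  suff /maxS yS : P (y |: S)%SET.
    have : y \in S by rewrite -yS ?finset.subsetUr// setU11.
    by move=> yS'; case/bigcupP: yNC; exists y.
  rewrite /P finset.subUset finset.sub1set yX SX/=.
  apply/forall_inP => a /setU1P[->|aS]; apply/forall_inP => b /setU1P[->|bS].
  - by rewrite ri.
  - by rewrite rs yNr.
  - exact: yNr.
  - exact: iS.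
exact: leq_trans (subset_leq_card sub) (card_bigcup_le _ _).
Qed.

Lemma exists_subset_card {T : finType} (A : {set T}) (m : nat) :
  (m <= #|A|)%N -> exists2 B : {set T}, B \subset A & #|B| = m.
Proof.
move=> mA; exists [set:: take m (enum A)].
  by apply/fintype.subsetP => x; rewrite inE => /mem_take; rewrite mem_enum.
rewrite cardsE (card_uniqP _) ?take_uniq ?enum_uniq// size_take -cardE.
by case: ltngtP mA.
Qed.

Lemma min_indegree_le {n} (D : sdigraph n) (i : 'I_n) :
  (min_indegree D <= #|in_nbr D i|)%N.
Proof.
rewrite /min_indegree; elim: (index_enum _) (mem_index_enum i) => // j r IH.
rewrite inE big_cons geq_min => /predU1P[->|/IH->]; first by rewrite leqnn.
by rewrite orbT.
Qed.

(** * Hoeffding's inequality for uniform bits *)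

(** Exponential moments: the indicator of a positive deviation [u] is at most [expR (l * u)], and
    the sum of these over the cube factorises over coordinates. *)
Lemma hoeffding_card_agree (R : realType) (T : finType) (A : {set T})
    (c : T -> bool) (t : R) : (0 < #|A|)%N -> 0 <= t ->
  #|[set x : {ffun T -> bool} |
      #|[set j in A | x j == c j]|%:R < #|A|%:R / 2 - t]|%:R
    <= 2 ^+ #|T| * expR (- (2 * t ^+ 2 / #|A|%:R)).
Proof.
move=> A0 t0; set d : R := #|A|%:R.
have d0 : 0 < d by rewrite ltr0n.
(* This value minimises the exponent [- (l * t) + d * l ^+ 2 / 8] of the final bound. *)
pose l := 4 * t / d.
have l0 : 0 <= l by rewrite divr_ge0 ?mulr_ge0 ?(ltW d0).
pose w (j : T) (b : bool) : R :=
  if j \in A then expR (l * (1 / 2 - (b == c j)%:R)) else 1.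
have mgf (x : {ffun T -> bool}) :
    expR (l * (d / 2 - t - #|[set j in A | x j == c j]|%:R))
    = expR (- (l * t)) * \prod_j w j (x j).
  rewrite /w -big_mkcond/= -expR_sum -expRD -mulr_sumr sumrB sumr_const.
  have -> : #|[set j in A | x j == c j]|%:R
      = \sum_(j in A) (x j == c j)%:R :> R.
    rewrite -sum1_card natr_sum big_mkcond [RHS]big_mkcond/=.
    by apply: eq_bigr => j _; rewrite inE; case: (j \in A) => //=; case: eqP.
  congr expR; rewrite -[_ *+ #|A|]mulr_natl -/d; by field.
have wle (j : T) : \sum_b w j b
    <= 2 * (if j \in A then expR (l ^+ 2 / 8) else 1).
  rewrite big_bool /w; case: (j \in A); last by rewrite mulr1.
  (* For either value of [c j], the two exponents are [l / 2] and [- (l / 2)]. *)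
  have -> : l ^+ 2 / 8 = (l / 2) ^+ 2 / 2 by field.
  apply: le_trans (cosh_le_expR_sqr _ _).
  rewrite le_eqVlt; apply/orP; left; apply/eqP.
  case: (c j) => /=; [rewrite addrC|]; congr (expR _ + expR _); by field.
rewrite [leRHS](_ : _
    = expR (- (l * t)) * (2 ^+ #|T| * expR (l ^+ 2 / 8) ^+ #|A|)); last first.
  rewrite [RHS]mulrCA -expRM_natl -expRD -/d; congr (_ * expR _).
  rewrite /l; field.
  by rewrite gt_eqF.
apply: (@le_trans _ _ (\sum_(x : {ffun T -> bool})
    expR (l * (d / 2 - t - #|[set j in A | x j == c j]|%:R)))).
  rewrite -sum1_card natr_sum big_mkcond/=; apply: ler_sum => x _.
  rewrite inE; case: ifPn => [xE|_]; last exact: expR_ge0.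
  apply: (le_trans _ (expR_ge1Dx _)); rewrite lerDl mulr_ge0// subr_ge0.
  exact: ltW.
under eq_bigr do rewrite mgf.
rewrite -mulr_sumr -(bigA_distr_bigA w) ler_wpM2l ?expR_ge0//.
apply: (@le_trans _ _
    (\prod_j (2 * (if j \in A then expR (l ^+ 2 / 8) else 1)))).
  apply: ler_prod => j _; rewrite wle andbT sumr_ge0// => b _.
  by rewrite /w; case: ifP => // _; exact: expR_ge0.
by rewrite big_split/= prodr_const -big_mkcond/= prodr_const.
Qed.

(** * Conflicts and the map fixing a conflict-free set *)

(* The chosen in-neighbours [j] of [i] whose signed value equals [x i]: those
   with [s j i = false] are read negated. *)
Definition supporters {n} (N : 'I_n -> {set 'I_n}) (s : 'I_n -> 'I_n -> bool)
    (x : config n) (i : 'I_n) : {set 'I_n} :=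
  [set j in N i | (x j == s j i) == x i].

(* If [x i] is true, the second conjunct says that [x] is below [y] on [N i]
   for the signed order, and if [x i] is false, that it is above. *)
Definition conflict {n} (N : 'I_n -> {set 'I_n}) (s : 'I_n -> 'I_n -> bool)
    : rel (config n) :=
  fun x y => [exists i, (x i != y i) &&
    [forall j in supporters N s x i, y j == x j]].

Lemma conflict_irr {n} (N : 'I_n -> {set 'I_n}) s : irreflexive (conflict N s).
Proof. by move=> x; apply/existsP => -[i]; rewrite eqxx. Qed.

(** If [j] supports [y] at [i] and [x j != y j], then, as [x i != y i], [j] also supports [x], where
    the two agree: a contradiction. *)
Lemma conflict_sym {n} (N : 'I_n -> {set 'I_n}) s : symmetric (conflict N s).
Proof.
suff H x y : conflict N s x y -> conflict N s y x.
  by move=> x y; apply/idP/idP; exact: H.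
case/existsP => i /andP[xyi /forall_inP xy]; apply/existsP; exists i.
rewrite eq_sym xyi/=; apply/forall_inP => j; rewrite inE => /andP[jN yj].
have := xy j; rewrite inE jN/=.
move: yj xyi.
by case: (x j); case: (y j); case: (x i); case: (y i); case: (s j i)
  => //= _ _ /(_ isT).
Qed.

Lemma exists_fixing_map {n} (D : sdigraph n) (N : 'I_n -> {set 'I_n})
    (S : {set config n}) :
  (forall i, N i \subset in_nbr D i) ->
  {in S &, forall x y, ~~ conflict N (fun j i => lab D j i != -1) x y} ->
  exists2 f, f \in FD D & S \subset Fix f.
Proof.
move=> ND noC; set s := (fun j i => lab D j i != -1) in noC.
(* As [x i] is true, the supporters are the signed ones of [x]; agreeing with [x] there means lying
   above [x] on [N i]. *)
pose f : {ffun config n -> config n} := [ffun z : config n => [ffun i =>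
  [exists x in S, x i && [forall j in supporters N s x i, z j == x j]]]].
have fE (z : config n) i : f z i =
    [exists x in S, x i && [forall j in supporters N s x i, z j == x j]].
  by rewrite !ffunE.
(* Treats both signs at once: a witness [x] for [z] remains one for [z'] unless coordinate [j] is
   flipped away from the value that [x] requires. *)
have mono (z z' : config n) (i j : 'I_n) :
    (forall k, k != j -> z k = z' k) ->
    (z j -> ~~ z' j ->
       forall x : config n, x i -> j \in supporters N s x i -> ~~ x j) ->
    (~~ z j -> z' j ->
       forall x : config n, x i -> j \in supporters N s x i -> x j) ->
    (f z i <= f z' i)%O.
  move=> zz' dn up.
  suff : f z i -> f z' i by case: (f z i); case: (f z' i) => // /(_ isT).
  rewrite [f z i]fE.
  case/exists_inP => x xS /andP[xi /forall_inP zx].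
  rewrite fE; apply/exists_inP; exists x; rewrite // xi/=.
  apply/forall_inP => k kx; rewrite -(eqP (zx k kx)).
  have [kj|kj] := eqVneq k j; last by rewrite zz'.
  rewrite kj in kx *.
  have dnj zj z'j := dn zj z'j x xi kx; have upj zj z'j := up zj z'j x xi kx.
  move: dnj upj (zx j kx).
  case: (z j); case: (z' j); case: (x j) => // dnj upj _.
    by have := dnj isT isT.
  by have := upj isT isT.
exists f.
  rewrite inE; apply/forallP => i; apply/and3P; split.
  - apply/'forall_forallP => y z; apply/implyP => /forall_inP yz.
    rewrite !fE; apply/eqP/eq_existsb => x; congr [&& _, _ & _].
    apply: eq_forallb_in => j; rewrite inE.
    case/andP => /(fintype.subsetP (ND i)) jD _.
    by rewrite (eqP (yz _ jD)).
  - apply/forall_inP => j; rewrite inE => /andP[_ /eqP lj].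
    apply/'forall_forallP => y z; apply/implyP => /andP[/forall_inP yz yzj].
    apply: (mono _ _ _ j) => [k kj|yj zj|_ _ x xi].
    + exact/eqP/yz.
    + by move: yzj; rewrite yj (negbTE zj).
    + by rewrite inE xi /s lj => /andP[_ /eqP]; case: (x j).
  - apply/forall_inP => j; rewrite inE => /andP[_ /eqP lj].
    apply/'forall_forallP => y z; apply/implyP => /andP[/forall_inP yz yzj].
    apply: (mono _ _ _ j) => [k kj|_ _ x xi|yj zj].
    + exact/esym/eqP/yz.
    + by rewrite inE xi /s lj eqxx => /andP[_ /eqP]; case: (x j).
    + by move: yzj; rewrite zj (negbTE yj).
apply/fintype.subsetP => z zS; rewrite inE; apply/eqP/ffunP => i.
rewrite fE; apply/exists_inP/idP => [[x xS /andP[xi zx]]|zi].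
  (* With [z i] false, the witness [x] would conflict with [z] at [i]. *)
  apply: contraT => zi; have := noC _ _ xS zS.
  by case/negP; apply/existsP; exists i; rewrite xi (negbTE zi) zx.
by exists z; rewrite // zi/=; apply/forall_inP.
Qed.

(** * Many balanced configurations, hence a large conflict-free set *)

Definition balanced {R : realType} {n} (N : 'I_n -> {set 'I_n}) s (a : R)
    : {set config n} :=
  [set x : config n | [forall i, a <= #|supporters N s x i|%:R]].

(** The condition on [t] makes each Hoeffding tail [1 / (4 * n)]; the [2 * n] bad events together
    contain at most half of the cube. *)
Lemma card_balanced (R : realType) n (N : 'I_n -> {set 'I_n}) s (d : nat)
    (t : R) :
  (0 < n)%N -> (0 < d)%N -> (forall i, #|N i| = d) -> 0 <= t ->
  ln (4 * n%:R) = 2 * t ^+ 2 / d%:R ->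
  2 ^+ n / 2 <= #|balanced N s (d%:R / 2 - t)|%:R :> R.
Proof.
move=> n0 d0 Nd t0 tE; set X := balanced _ _ _.
have n0' : 0 < n%:R :> R by rewrite ltr0n.
(* Hoeffding needs a fixed target, whereas [supporters] compares with [x i]; hence the union over
   both possible values [p.2]. *)
pose B (p : 'I_n * bool) := [set x : config n |
  #|[set j in N p.1 | x j == (s j p.1 == p.2)]|%:R < d%:R / 2 - t].
have sub : (~: X)%SET \subset \bigcup_p B p.
  apply/fintype.subsetP => x; rewrite !inE negb_forall => /existsP[i].
  rewrite -ltNge => xi; apply/bigcupP; exists (i, x i) => //.
  rewrite inE/=; apply: le_lt_trans xi; rewrite ler_nat.
  apply: subset_leq_card; apply/fintype.subsetP => j; rewrite !inE.
  by case/andP => ->; case: (x j); case: (s j i); case: (x i).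
have Ble p : #|B p|%:R <= 2 ^+ n / (4 * n%:R) :> R.
  have := @hoeffding_card_agree R _ (N p.1) (fun j => s j p.1 == p.2) t.
  rewrite Nd => /(_ d0 t0) /le_trans; apply.
  by rewrite -tE expRN lnK ?card_ord// posrE mulr_gt0.
have CX : #|(~: X)%SET|%:R <= 2 ^+ n / 2 :> R.
  have := leq_trans (subset_leq_card sub) (card_bigcup_le _ _).
  rewrite -(ler_nat R) natr_sum => /le_trans; apply.
  apply: le_trans (ler_sum _ (fun p _ => Ble p)) _.
  rewrite sumr_const card_prod card_bool card_ord -[leLHS]mulr_natl natrM.
  rewrite le_eqVlt; apply/orP; left; apply/eqP; field.
  by rewrite gt_eqF.
have := cardsC X; rewrite card_ffun card_bool card_ord.
move/(congr1 (GRing.natmul (1 : R))).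
rewrite natrD natrX; lra.
Qed.

Lemma exists_conflict_free (R : realType) n (N : 'I_n -> {set 'I_n}) s (d : nat)
    (t : R) :
  (0 < n)%N -> (0 < d)%N -> (forall i, #|N i| = d) -> 0 <= t ->
  ln (4 * n%:R) = 2 * t ^+ 2 / d%:R ->
  exists2 S : {set config n}, {in S &, forall x y, ~~ conflict N s x y}
    & 2 `^ (d%:R / 2 - t) <= 2 * n%:R * #|S|%:R.
Proof.
move=> n0 d0 Nd t0 tE; have := @card_balanced R n N s d t n0 d0 Nd t0 tE.
set a := d%:R / 2 - t; set X := balanced _ _ _ => Xge.
(* A union of [n] subcubes, each of codimension at least [a] when [x] is balanced. Omitting
   [x i != y i] puts [x] itself in [C x]. *)
pose C (x : config n) := \bigcup_i
  [set y : config n | [forall j in supporters N s x i, y j == x j]].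
have xC x : x \in C x.
  apply/bigcupP; exists (Ordinal n0); rewrite // inE.
  exact/forall_inP.
have confC x y : conflict N s x y -> y \in C x.
  by case/existsP => i /andP[_ xy]; apply/bigcupP; exists i; rewrite // inE.
have [S [SX indep Sle]] := exists_independent_cover _ X C
  (conflict_sym N s) (conflict_irr N s) xC confC.
exists S => //.
have Cle x : x \in S -> #|C x|%:R <= n%:R * (2 ^+ n * 2 `^ (- a)) :> R.
  move=> /(fintype.subsetP SX); rewrite inE => /forallP xX.
  apply: (@le_trans _ _ (\sum_(i < n) (2 ^+ n * 2 `^ (- a)))); last first.
    by rewrite sumr_const card_ord mulr_natl.
  have := card_bigcup_le xpredT (fun i =>
    [set y : config n | [forall j in supporters N s x i, y j == x j]]).
  rewrite -(ler_nat R) natr_sum => /le_trans; apply.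
  apply: ler_sum => i _; rewrite card_agree card_ord natrX.
  have kn : (#|supporters N s x i| <= n)%N.
    by rewrite -[leqRHS]card_ord max_card.
  rewrite -!powR_mulrn// -powRD ?pnatr_eq0 ?implybT//.
  by rewrite ler_powR ?ler1n// natrB// lerD2l lerN2.
have : 2 ^+ n / 2 <= #|S|%:R * (n%:R * (2 ^+ n * 2 `^ (- a))).
  apply: le_trans Xge _; move: Sle; rewrite -(ler_nat R) natr_sum.
  move/le_trans; apply; apply: le_trans (ler_sum _ Cle) _.
  by rewrite sumr_const -[leLHS]mulr_natl.
have p0 : 0 < 2 `^ a :> R by rewrite powR_gt0.
have e0 : 0 < 2 ^+ n :> R by rewrite exprn_gt0.
rewrite powRN => H.
rewrite -(ler_pM2l (divr_gt0 (divr_gt0 e0 (ltr0n R 2)) p0)).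
rewrite (_ : _ * (2 * n%:R * #|S|%:R) = #|S|%:R * (n%:R * (2 ^+ n / 2 `^ a))).
  by rewrite divfK ?gt_eqF.
by field; rewrite gt_eqF.
Qed.

Theorem theorem3 (R : realType) (n : nat) (hn : (0 < n)%N) (D : sdigraph n)
  (delta : R := (min_indegree D)%:R)
  (hdelta : delta >= ln (4 * n%:R) / 2) :
  guessing_number R D >=
    delta / 2 - Num.sqrt (ln (4 * n%:R) * delta / 2) - log2 n%:R - 1.
Proof.
have n1 : 1 <= n%:R :> R by rewrite ler1n.
have n0 : 0 < n%:R :> R by rewrite ltr0n.
have L0 : 0 < ln (4 * n%:R) :> R by apply: ln_gt0; lra.
have delta0 : 0 < delta by apply: lt_le_trans hdelta; rewrite divr_gt0.
have d0 : (0 < min_indegree D)%N by rewrite -(ltr0n R).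
set t := Num.sqrt _.
have tE : ln (4 * n%:R) = 2 * t ^+ 2 / delta.
  rewrite sqr_sqrtr; first by field; rewrite gt_eqF.
  by rewrite divr_ge0// mulr_ge0// ltW.
(* Trimming all neighbourhoods to the same size lets one [t] serve every vertex. *)
have exN (i : 'I_n) : exists A : {set 'I_n},
    A \subset in_nbr D i /\ #|A| = min_indegree D.
  by have [A] := exists_subset_card _ _ (min_indegree_le D i); exists A.
have [N NP] := fin_all_exists exN.
have [S indep Sge] := exists_conflict_free R n N
  (fun j i => lab D j i != -1) _ _
  hn d0 (fun i => (NP i).2) (sqrtr_ge0 _) tE.
have [f fD SF] := exists_fixing_map D N S (fun i => (NP i).1) indep.
apply: le_trans (guessing_number_ge R fD).
have ln2 : 0 < ln 2 :> R by rewrite ln_gt0// ltr1n.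
(* Positivity is required to compare logarithms, since [ln 0] is 0 by convention. *)
have F0 : 0 < #|Fix f|%:R :> R.
  rewrite ltr0n; apply: leq_trans (subset_leq_card SF).
  rewrite -(ltr0n R) -(pmulr_rgt0 _ (_ : 0 < 2 * n%:R)); last lra.
  by apply: lt_le_trans Sge; rewrite powR_gt0.
have : 2 `^ (delta / 2 - t) <= 2 * n%:R * #|Fix f|%:R.
  by apply: le_trans Sge _; rewrite ler_pM2l ?ler_nat ?subset_leq_card//; lra.
have n20 : 0 < 2 * n%:R :> R by rewrite mulr_gt0.
have nF0 := mulr_gt0 n20 F0.
(* In base 2, the factor [2 * n%:R] costs the terms [log2 n%:R] and 1. *)
rewrite -(ler_ln (powR_gt0 _ (ltr0n R 2)) nF0) ln_powR !lnM ?posrE// => H.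
rewrite /log2 -(ler_pM2r ln2) !mulrBl mul1r !divfK ?gt_eqF//.
rewrite -mulrBl; lra.
Qed.
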